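(* Let $\Gamma$ be an infinite set. Then the space $\ell_{\infty}(\Gamma)$ satisfies the Mazur-Ulam property; that is, for each complex Banach space $X$, every surjective isometry $\Delta: S(\ell_{\infty}(\Gamma)) \to S(X)$ admits a unique extension to a surjective real linear isometry from $\ell_{\infty}(\Gamma)$ onto $X$.
   Context: $\ell_{\infty}(\Gamma)$ denotes the complex Banach space of all bounded complex-valued functions on the set $\Gamma$, equipped with the supremum norm. For a Banach space $X$, $S(X)=\{x\in X:\|x\|=1\}$ denotes its unit sphere. A surjective isometry $\Delta: S(\ell_\infty(\Gamma))\to S(X)$ is a surjective map (no linearity assumed) satisfying $\|\Delta(x)-\Delta(y)\|=\|x-y\|$ for all $x,y\in S(\ell_\infty(\Gamma))$. *)

(* Defs.v *)
From HB Require Import structures.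
From mathcomp Require Import all_boot all_order all_algebra complex.
From mathcomp Require Import all_classical all_reals all_analysis.

Set Implicit Arguments.
Unset Strict Implicit.
Unset Printing Implicit Defensive.

Import Order.TTheory GRing.Theory Num.Theory.
Import numFieldNormedType.Exports.
Import ComplexField.Normc.

Local Open Scope classical_set_scope.
Local Open Scope ring_scope.
Local Open Scope complex_scope.

(* In [normedModType R[i]] the norm takes its values in [R[i]]; on [R[i]] itself
   the norm of [z] is [(normc z)%:C], where [normc z : R]. *)

Section linf_space.
Context {R : realType} {G : Type}.
Implicit Types f g : G -> R[i].

Definition linf_pred : {pred G -> R[i]} :=
  mem [set f : G -> R[i] | has_ubound [set normc (f x) | x in [set: G]]].

Lemma linf_predP f :
  reflect (exists M : R, forall x, normc (f x) <= M) (f \in linf_pred).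
Proof.
apply: (iffP idP) => [|[M fM]]; rewrite inE.
  by case=> M fM; exists M => x; apply: fM; exists x.
by exists M => _ [x _ <-]; exact: fM.
Qed.

Lemma linf_submod_closed : submod_closed linf_pred.
Proof.
split=> [|a f g /linf_predP[M fM] /linf_predP[N gN]]; apply/linf_predP.
  by exists 0 => x; rewrite [X in normc X]/(0 : R[i]) normc0.
exists (normc a * M + N) => x; apply: le_trans (le_normcD _ _) _.
rewrite lerD// normcM ler_wpM2l//.
by rewrite -lecR; exact: (normr_ge0 a).
Qed.

HB.instance Definition _ :=
  GRing.isSubmodClosed.Build R[i] (G -> R[i]) linf_pred linf_submod_closed.

End linf_space.
Arguments linf_pred : clear implicits.

Record linf (R : realType) (G : Type) := Linf {
  linf_fun :> G -> R[i];
  linf_funP : linf_fun \in linf_pred R G }.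

Section linf_normed.
Context {R : realType} {G : Type}.
Local Notation E := (linf R G).

HB.instance Definition _ := [isSub for @linf_fun R G].
HB.instance Definition _ := [Choice of E by <:].
HB.instance Definition _ := [SubChoice_isSubLmodule of E by <:].

Definition linf_norm (f : E) : R[i] :=
  (sup [set normc (f x) | x in [set: G]])%:C.

Lemma linf_eq (f g : E) : f =1 g -> f = g.
Proof. by move=> fg; apply/val_inj/funext. Qed.

Lemma linfD (f g : E) x : (f + g) x = f x + g x.
Proof. by []. Qed.

Lemma linfN (f : E) x : (- f) x = - f x.
Proof. by []. Qed.

Lemma linfZ a (f : E) x : (a *: f) x = a * f x.
Proof. by []. Qed.

Lemma normc_ge0 (z : R[i]) : 0 <= normc z.
Proof. by rewrite -lecR; exact: (normr_ge0 z). Qed.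

Lemma linf_norm_ub (f : E) x : (normc (f x))%:C <= linf_norm f.
Proof.
rewrite lecR; apply: ub_le_sup; last by exists x.
by have := linf_funP f; rewrite inE.
Qed.

Lemma linf_norm_le (f : E) (M : R) :
  0 <= M -> (forall x, normc (f x) <= M) -> linf_norm f <= M%:C.
Proof.
move=> M0 fM; rewrite lecR.
have [->|ne] := eqVneq [set normc (f x) | x in [set: G]] set0.
  by rewrite sup0.
by apply: ge_sup; [exact/set0P|move=> _ [x _ <-]].
Qed.

Lemma linf_norm_ge0 (f : E) : 0 <= sup [set normc (f x) | x in [set: G]].
Proof.
have [->|/set0P[_ [x _ _]]] := eqVneq [set normc (f x) | x in [set: G]] set0.
  by rewrite sup0.
by apply: le_trans (normc_ge0 (f x)) _; rewrite -lecR; exact: linf_norm_ub.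
Qed.

Lemma linf_normD (f g : E) : linf_norm (f + g) <= linf_norm f + linf_norm g.
Proof.
rewrite -rmorphD/=; apply: linf_norm_le.
  by rewrite addr_ge0// linf_norm_ge0.
move=> x; rewrite linfD; apply: le_trans (le_normcD _ _) _.
by rewrite lerD// -lecR; exact: linf_norm_ub.
Qed.

Lemma linf_normZ_le a (f : E) : linf_norm (a *: f) <= `|a| * linf_norm f.
Proof.
have -> : `|a| * linf_norm f =
    (normc a * sup [set normc (f x) | x in [set: G]])%:C by rewrite rmorphM.
apply: linf_norm_le.
  by rewrite mulr_ge0 ?normc_ge0 ?linf_norm_ge0.
move=> x; rewrite linfZ normcM ler_wpM2l ?normc_ge0//.
by rewrite -lecR; exact: linf_norm_ub.
Qed.

Lemma linf_norm0_eq0 (f : E) : linf_norm f = 0 -> f = 0.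
Proof.
move=> f0; apply: linf_eq => x.
have -> : (0 : E) x = 0.
  by [].
apply: eq0_normc; apply/eqP; rewrite eq_le normc_ge0 andbT.
by have := linf_norm_ub f x; rewrite f0 lecR.
Qed.

Lemma linf_normZ a (f : E) : linf_norm (a *: f) = `|a| * linf_norm f.
Proof.
apply/eqP; rewrite eq_le linf_normZ_le/=.
have [->|a0] := eqVneq a 0; first by rewrite normr0 mul0r lecR linf_norm_ge0.
rewrite -{1}(scalerK a0 f) mulrC -ler_pdivlMr ?normr_gt0//.
by apply: le_trans (linf_normZ_le _ _) _; rewrite normfV mulrC.
Qed.

HB.instance Definition _ := Lmodule_isNormed.Build R[i] E
  linf_normD linf_normZ linf_norm0_eq0.

Lemma linf_normE (f : E) :
  `|f| = (sup [set normc (f x) | x in [set: G]])%:C.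
Proof. by []. Qed.

Lemma normc_ReIm (z : R[i]) : normc z <= `|complex.Re z| + `|complex.Im z|.
Proof.
case: z => a b /=.
rewrite -[leRHS]ger0_norm ?addr_ge0// -sqrtr_sqr ler_wsqrtr//.
rewrite sqrrD !real_normK ?num_real// lerD2r lerDl.
by rewrite mulrn_wge0// mulr_ge0.
Qed.

Lemma Re_le_normc (z : R[i]) : `|complex.Re z| <= normc z.
Proof. by case: z => a b /=; rewrite -sqrtr_sqr ler_wsqrtr// lerDl sqr_ge0. Qed.

Lemma Im_le_normc (z : R[i]) : `|complex.Im z| <= normc z.
Proof. by case: z => a b /=; rewrite -sqrtr_sqr ler_wsqrtr// lerDr sqr_ge0. Qed.

Lemma linf_part_cvg (p : R[i] -> R) (F : set_system E) :
  {morph p : x y / x - y} -> (forall z, `|p z| <= normc z) ->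
  ProperFilter F -> cauchy F ->
  exists l : G -> R, forall A (e : R), F A ->
    (forall f g : E, A f -> A g -> `|f - g| < e%:C) ->
    forall (f : E) x, A f -> `|p (f x) - l x| <= e.
Proof.
move=> pB pn FF /cauchy_ballP Fc.
pose Fx x : set_system R := (fun f : E => p (f x)) @ F.
have small A (e : R) f g x : (forall f g : E, A f -> A g -> `|f - g| < e%:C) ->
    A f -> A g -> `|p (f x) - p (g x)| < e.
  move=> Ae Af Ag; rewrite -pB -linfN -linfD -ltcR.
  apply: le_lt_trans (Ae _ _ Af Ag).
  apply: le_trans (linf_norm_ub (f - g) x).
  by rewrite lecR; exact: pn.
have cv x : cvg (Fx x).
  apply: cauchy_cvg; apply/cauchy_ballP => e e0.
  have e0' : 0 < e%:C by rewrite ltcR.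
  have [[A B] /= [FA FB] AB] := Fc _ e0'.
  exists ([set p (f x) | f in A `&` B], [set p (f x) | f in A `&` B]) => /=.
    have FC : Fx x [set p (f x) | f in A `&` B].
      by apply: filterS (filterI FA FB) => f ABf; exists f.
    by split.
  move=> [_ _] /= [[f [Af Bf] <-] [g [Ag Bg] <-]].
  rewrite -ball_normE/=.
  rewrite -pB -linfN -linfD -ltcR.
  have /AB : (A `*` B) (f, g) by [].
  rewrite /= -ball_normE/= => fg; apply: le_lt_trans fg.
  by apply: le_trans (linf_norm_ub (f - g) x); rewrite lecR; exact: pn.
exists (fun x => lim (Fx x)) => A e FA Ae f x Af.
have cf : (fun g : E => `|p (f x) - p (g x)|) @ F --> `|p (f x) - lim (Fx x)|.
  by apply: cvg_norm; apply: cvgB; [exact: cvg_cst|exact: cv].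
rewrite -(cvg_lim _ cf)//; apply: limr_le; first exact: cvgP cf.
by apply: filterS FA => g Ag; apply/ltW/(small A).
Qed.

Lemma linf_complete (F : set_system E) :
  ProperFilter F -> cauchy F -> cvg F.
Proof.
move=> FF Fc.
have ReB : {morph (@complex.Re R) : x y / x - y} by move=> [a b] [c d].
have ImB : {morph (@complex.Im R) : x y / x - y} by move=> [a b] [c d].
have [a Ha] := linf_part_cvg ReB Re_le_normc FF Fc.
have [b Hb] := linf_part_cvg ImB Im_le_normc FF Fc.
pose l : G -> R[i] := fun x => a x +i* b x.
have small (e : R) : 0 < e ->
    exists2 A, F A & forall (f : E) x, A f -> normc (f x - l x) <= e.
  move=> e0.
  have e0' : 0 < (e / 2)%:C by rewrite ltcR divr_gt0.
  have /cauchy_ballP/(_ _ e0')[[A B] /= [FA FB] AB] := Fc.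
  have FAB : F (A `&` B) by exact: filterI.
  have ABe (f g : E) : (A `&` B) f -> (A `&` B) g -> `|f - g| < (e / 2)%:C.
    move=> [Af _] [_ Bg]; have /AB : (A `*` B) (f, g) by [].
    by rewrite /= -ball_normE.
  exists (A `&` B) => // f x ABf.
  apply: le_trans (normc_ReIm _) _; rewrite ReB ImB /= (splitr e).
  by rewrite lerD//; [exact: (Ha _ _ FAB ABe)|exact: (Hb _ _ FAB ABe)].
have l_bd : l \in linf_pred R G.
  have [A FA Al] := small 1 ltr01.
  have [f Af] := filter_ex FA.
  have /linf_predP[M fM] := linf_funP f.
  apply/linf_predP; exists (1 + M) => x.
  rewrite -(subrK (f x) (l x)); apply: le_trans (le_normcD _ _) _.
  rewrite lerD//; apply: le_trans (Al f x Af).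
  by rewrite -lecR -[leLHS]/(`|l x - f x|) distrC.
apply/cvg_ex; exists (Linf l_bd); apply/cvgrPdist_le => e e0.
have eR : e = (complex.Re e)%:C.
  by case: e e0 => u v; rewrite ltcE/= => /andP[/eqP -> _].
move: e0; rewrite {}eR ltcR => e0.
have [A FA Al] := small _ e0.
apply: filterS FA => f Af; apply: linf_norm_le; first exact: ltW.
move=> x; rewrite linfD linfN; apply: le_trans (Al f x Af).
by rewrite -lecR -[leLHS]/(`|l x - f x|) distrC.
Qed.

HB.instance Definition _ := Uniform_isComplete.Build E linf_complete.

End linf_normed.

Definition unit_sphere {K : numFieldType} (E : normedModType K) : set E :=
  [set x | `|x| = 1].
Arguments unit_sphere {K} E _.

Definition surjective_isometry {K : numFieldType} (E X : normedModType K)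
    (A : set E) (B : set X) (f : E -> X) : Prop :=
  [/\ set_fun A B f, set_surj A B f &
      forall x y, A x -> A y -> `|f x - f y| = `|x - y|].

Definition real_linear {R : realType} (E X : lmodType R[i]) (T : E -> X) : Prop :=
  forall (a : R) (x y : E), T (a%:C *: x + y) = a%:C *: T x + T y.

(* A map between unit spheres is represented by a function on the whole of [E]
   whose values off the sphere are irrelevant. *)
Definition mazur_ulam_property {R : realType}
    (E : completeNormedModType R[i]) : Prop :=
  forall (X : completeNormedModType R[i]) (Delta : E -> X),
    surjective_isometry (unit_sphere E) (unit_sphere X) Delta ->
    exists! T : E -> X,
      [/\ real_linear T,
          surjective_isometry [set: E] [set: X] T &
          forall x, unit_sphere E x -> T x = Delta x].

(* Main.v *)
Require Import Defs.
From mathcomp Require Import all_boot all_order all_algebra complex ring lra.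
From mathcomp Require Import all_classical all_reals all_analysis.

Set Implicit Arguments.
Unset Strict Implicit.
Unset Printing Implicit Defensive.

Import Order.TTheory GRing.Theory Num.Theory.
Import numFieldNormedType.Exports.
Import ComplexField.Normc.

Local Open Scope classical_set_scope.
Local Open Scope ring_scope.
Local Open Scope complex_scope.

(** Let [Delta] be a surjective isometry from the sphere of [linf R G] onto the
    sphere of [X]. The only candidate for the extension is the homogeneous one,
    [hom_ext Delta], and the point is that it is additive. In [linf R G] the
    coordinates [x |-> Re (conj l * x g)], with [l] unimodular, are the real
    functionals that support the faces [face g l] of the ball. If for every
    such face there is a norm-one functional [phi] on [X] with
    [phi (Delta x) = Re (conj l * x g)] for all [x] in the sphere, then
    additivity follows: by surjectivity the sum of the images of [x] and [y] is
    the image of some [w], and the functionals show that [w] has the same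
    coordinates as [x + y] ([hom_extD]).

    The functionals come from the images of the faces. A face is recognized
    metrically, as the set of points of the sphere at distance [2] from a bump
    function ([peaked_far], [face_far]). This implies that the image of a face
    is convex, and that images of opposite faces are opposite
    ([face_opp], [face_image_convex]). Therefore there are functionals [phi]
    equal to [1] on the image of [face g l] and to [- 1] on that of
    [face g (- l)]; all bounds on them that are used are expressed by the
    predicate [support_le].

    Comparing a point [y] of the sphere with the opposite face gives
    [phi (Delta y) <= normc (l + y g) - 1] ([face_le_normc]), which is the
    wanted value up to an error of second order in [y g]. To remove the error,
    use that [Delta] respects the midpoint of two points of a face whenever
    their difference has constant modulus at all other indices
    ([face_midpoint]): such points have only one metric midpoint. If [y] is
    unimodular at some [d <> g], then [y] lies on a segment of the face at [d]
    which starts at a function vanishing at [g] and any two points of which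
    form such a pair; on it [phi] is affine, so it is determined by its
    first-order behaviour ([face_le_cdot_attained]). The remaining points are
    limits of such points or of midpoints of such points ([face_le_cdot]).
    Applied to [l] and [- l], the upper bounds give the value of [phi]. *)

Local Notation "a *:r v" := (a%:C *: v) (at level 40, v at next level).

(** * The Euclidean plane of complex numbers *)

Section complex_plane.
Context {R : realType}.
Implicit Types (z w l : R[i]) (a t : R).

Definition normc2 z : R := complex.Re z ^+ 2 + complex.Im z ^+ 2.

Lemma sqr_normc z : normc z ^+ 2 = normc2 z.
Proof. by case: z => a b; rewrite /= sqr_sqrtr// addr_ge0// sqr_ge0. Qed.

Lemma normc_le a z : 0 <= a -> (normc z <= a) = (normc2 z <= a ^+ 2).
Proof. by move=> a0; rewrite -sqr_normc ler_pXn2r// nnegrE normc_ge0. Qed.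

Lemma normc_abs a : normc a%:C = `|a|.
Proof. by rewrite /= expr0n addr0 sqrtr_sqr. Qed.

Lemma normc_real a : 0 <= a -> normc a%:C = a.
Proof. by move=> a0; rewrite normc_abs ger0_norm. Qed.

(** The value [1] at [0] makes [dirc] unimodular everywhere, so that
    real multiples of [dirc \o f] are directions of constant modulus, pointing
    along [f] at each index. *)
Definition dirc z : R[i] := if z == 0 then 1 else z / (normc z)%:C.

Lemma polarE z : z = (normc z)%:C * dirc z.
Proof.
rewrite /dirc; have [->|z0] := eqVneq z 0; first by rewrite normc0 mul0r.
rewrite mulrC divfK// eq_complex/= eqxx andbT.
by apply: contra_neq z0 => /eq0_normc.
Qed.

Lemma normc_dirc z : normc (dirc z) = 1.
Proof.
rewrite /dirc; have [_|z0] := eqVneq z 0; first exact: normc1.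
have nz0 : normc z != 0 by apply: contra_neq z0 => /eq0_normc.
by rewrite normcM normcV normc_real ?normc_ge0// divff.
Qed.

Lemma normc_scale_dirc z w : normc (z * dirc w) = normc z.
Proof. by rewrite normcM normc_dirc mulr1. Qed.

(** Real part of [conj l * z]. *)
Definition cdot l z : R :=
  complex.Re l * complex.Re z + complex.Im l * complex.Im z.

Lemma cdotD l z w : cdot l (z + w) = cdot l z + cdot l w.
Proof. by case: z w => [a b] [c d]; rewrite /cdot/=; ring. Qed.

Lemma cdotZ l a z : cdot l (a%:C * z) = a * cdot l z.
Proof. by case: z => [b c]; rewrite /cdot/=; ring. Qed.

Lemma cdotNl l z : cdot (- l) z = - cdot l z.
Proof. by case: l z => [a b] [c d]; rewrite /cdot/=; ring. Qed.

(** [cdot l] is the derivative of [normc] at the unimodular number [l], with a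
    quadratic error. *)
Lemma normcD_le_cdot l z : normc l = 1 ->
  normc (l + z) - 1 <= cdot l z + normc2 z / 2.
Proof.
move=> l1; have: normc2 l = 1 by rewrite -sqr_normc l1 expr1n.
case: l {l1} => a b; case: z => x y; rewrite /cdot /normc2/= => ab1.
set e := (X in _ <= X).
have eE : (a + x) ^+ 2 + (b + y) ^+ 2 = 1 + 2 * e.
  transitivity ((a ^+ 2 + b ^+ 2) + 2 * e); last by rewrite ab1.
  by rewrite /e; field.
clearbody e; have e1 : 0 <= 1 + 2 * e by rewrite -eE addr_ge0// sqr_ge0.
rewrite lerBlDl -[leLHS]/(normc ((a + x) +i* (b + y))) normc_le /normc2/= ?eE.
  by move: (sqr_ge0 e); rewrite sqrrD expr1n; lra.
by lra.
Qed.

(** A number is determined by its supporting half-planes: the directions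
    [1, -1, 'i, - 'i] already bound both coordinates from both sides. *)
Lemma cdot_inj z w : (forall l, normc l = 1 -> cdot l w <= cdot l z) -> w = z.
Proof.
case: z w => [a b] [c d] H.
have n1 : normc (1 : R[i]) = 1 by exact: normc1.
have ni : normc ('i : R[i]) = 1 by rewrite /= expr0n expr1n add0r sqrtr1.
move: (H _ n1) (H (-1)) (H _ ni) (H (- 'i)); rewrite !normcN n1 ni.
move=> + /(_ erefl) + + /(_ erefl); rewrite !cdotNl /cdot/= => *.
by congr (_ +i* _); lra.
Qed.

(** Metric midpoints are unique in the Euclidean plane, by the parallelogram
    law. This is what makes the isometry respect midpoints in
    [face_midpoint]. *)
Lemma metric_midpointc z (a b : R[i]) (r : R) :
  0 <= r -> normc (a - b) = 2 * r ->
  normc (z - a) <= r -> normc (z - b) <= r -> z = 2^-1%:C * (a + b).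
Proof.
move=> r0 abr; rewrite !normc_le// => za zb.
have: normc2 (a - b) = (2 * r) ^+ 2 by rewrite -sqr_normc abr.
move: za zb {abr}.
case: z a b => [x y] [a1 a2] [b1 b2]; rewrite /normc2/= => za zb ab.
have : (2 * x - a1 - b1) ^+ 2 + (2 * y - a2 - b2) ^+ 2 <= 0 by nra.
have X := sqr_ge0 (2 * x - a1 - b1); have Y := sqr_ge0 (2 * y - a2 - b2).
move=> XY.
have /eqP : (2 * x - a1 - b1) ^+ 2 = 0 by lra.
have /eqP : (2 * y - a2 - b2) ^+ 2 = 0 by lra.
rewrite !sqrf_eq0 => /eqP Y0 /eqP X0.
by apply/eqP; rewrite eq_complex/=; apply/andP; split; apply/eqP; lra.
Qed.

Lemma halfcD z : 2^-1%:C * (z + z) = z.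
Proof. by rewrite mulrDr -mulrDl -rmorphD/= -[2^-1]div1r -splitr mul1r. Qed.

End complex_plane.

(** * Real-valued norms and real scalars *)

Section real_scaling.
Context {R : realType} {V : lmodType R[i]}.
Implicit Types (u v w : V) (a b : R).

Lemma rscalerDl a b v : (a + b) *:r v = a *:r v + b *:r v.
Proof. by rewrite rmorphD scalerDl. Qed.

Lemma rscalerA a b v : a *:r (b *:r v) = (a * b) *:r v.
Proof. by rewrite scalerA rmorphM. Qed.

Lemma rcombD a u v w :
  a *:r (u + w) + (1 - a) *:r (v + w) = a *:r u + (1 - a) *:r v + w.
Proof.
by rewrite !scalerDr addrACA -[X in _ + X]rscalerDl [a + _]addrC subrK scale1r.
Qed.

Lemma rscalerKV a v : a != 0 ->
  a *:r (a^-1 *:r v) = v.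
Proof. by move=> a0; rewrite rscalerA divff// scale1r. Qed.

Lemma rhalfD v : 2^-1 *:r (v + v) = v.
Proof. by rewrite scalerDr -rscalerDl -[2^-1]div1r -splitr scale1r. Qed.

End real_scaling.

Section real_norm.
Context {R : realType} {V : normedModType R[i]}.
Implicit Types (u v w : V) (a : R).

(** The norm as a real number instead of a complex number with zero imaginary
    part. *)
Definition rnorm v : R := complex.Re `|v|.

Lemma rnormE v : `|v| = (rnorm v)%:C.
Proof. by rewrite /rnorm RRe_real// ger0_real. Qed.

Lemma rnorm_ge0 v : 0 <= rnorm v.
Proof. by rewrite -lecR -rnormE; exact: normr_ge0. Qed.

Lemma rnormD v w : rnorm (v + w) <= rnorm v + rnorm w.
Proof. by rewrite -lecR rmorphD/= -!rnormE ler_normD. Qed.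

Lemma rnormN v : rnorm (- v) = rnorm v.
Proof. by rewrite /rnorm normrN. Qed.

Lemma rnorm_distC v w : rnorm (v - w) = rnorm (w - v).
Proof. by rewrite /rnorm distrC. Qed.

Lemma rnormZ a v : 0 <= a -> rnorm (a *:r v) = a * rnorm v.
Proof.
move=> a0; rewrite {1}/rnorm normrZ rnormE.
by rewrite ger0_norm ?lecR// -rmorphM.
Qed.

Lemma rnorm0 : rnorm (0 : V) = 0.
Proof. by rewrite /rnorm normr0. Qed.

Lemma rnorm0_eq0 v : rnorm v = 0 -> v = 0.
Proof. by move=> v0; apply/normr0_eq0; rewrite rnormE v0. Qed.

Lemma unit_sphereE v : unit_sphere V v <-> rnorm v = 1.
Proof.
rewrite /unit_sphere/= rnormE; split=> [/eqP|->//].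
by rewrite eq_complex/= => /andP[/eqP].
Qed.

Lemma rnorm_normalize v : v != 0 ->
  0 < rnorm v /\ rnorm ((rnorm v)^-1 *:r v) = 1.
Proof.
move=> v0; have vn0 : rnorm v != 0 by apply: contra_neq v0 => /rnorm0_eq0.
have vp : 0 < rnorm v by rewrite lt_def vn0 rnorm_ge0.
by rewrite rnormZ ?invr_ge0 ?rnorm_ge0// mulVf.
Qed.

(** If the midpoint of two unit vectors is on the sphere, so is the whole
    segment: a point and its mirror image in the midpoint have norm at most
    [1], and their sum has norm [2]. *)
Lemma rnorm_convex_comb (t : R) u v : rnorm u = 1 -> rnorm v = 1 ->
  rnorm (u + v) = 2 -> 0 <= t -> t <= 1 ->
  rnorm (t *:r u + (1 - t) *:r v) = 1.
Proof.
move=> u1 v1 uv t0 t1; have t1' : 0 <= 1 - t by lra.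
apply/le_anti/andP; split.
  apply: le_trans (rnormD _ _) _; rewrite !rnormZ// u1 v1; lra.
have : rnorm (u + v) <= rnorm (t *:r u + (1 - t) *:r v) +
   rnorm ((1 - t) *:r u + t *:r v).
  apply: le_trans (rnormD _ _); rewrite addrACA -!rscalerDl.
  by rewrite addrC !subrK addrC [t + _]addrC subrK !scale1r addrC.
have : rnorm ((1 - t) *:r u + t *:r v) <= 1.
  by apply: le_trans (rnormD _ _) _; rewrite !rnormZ// u1 v1; lra.
by lra.
Qed.

End real_norm.

(** * Upper bounds for functionals supporting a convex part of the sphere *)

Section support.
Context {R : realType} {V : normedModType R[i]}.
Implicit Types (C : set V) (u v w c d : V) (a r s t e : R).

Definition rconvex C := forall c d t, C c -> C d -> 0 <= t -> t <= 1 ->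
  C (t *:r c + (1 - t) *:r d).

(** For a convex subset [C] of the unit sphere, the infimum of the admissible
    [r] is the largest sublinear functional [p] with [p v <= rnorm v] and
    [p (- c) <= - 1] for [c] in [C]; hence [r] bounds [phi v] for all real
    functionals [phi] of norm [1] that are equal to [1] on [C]. Working with
    these bounds gives what is needed of the functionals without choosing one
    by the Hahn-Banach theorem. *)
Definition support_le C v r := forall e, 0 < e ->
  exists a c, [/\ 0 <= a, C c & rnorm (v + a *:r c) <= a + r + e].

Lemma support_leW C v r s : r <= s -> support_le C v r -> support_le C v s.
Proof.
move=> rs vr e /vr[a [c [a0 Cc H]]]; exists a, c; split=> //.
by apply: le_trans H _; rewrite lerD2r lerD2l.
Qed.

Lemma support_le_closed C v r :
  (forall e, 0 < e -> support_le C v (r + e)) -> support_le C v r.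
Proof.
move=> H e e0; have e20 : 0 < e / 2 by rewrite divr_gt0.
have [a [c [a0 Cc ac]]] := H _ e20 _ e20.
by exists a, c; split=> //; apply: le_trans ac _; lra.
Qed.

Lemma support_le_rnorm C v : C !=set0 -> support_le C v (rnorm v).
Proof.
move=> [c Cc] e e0; exists 0, c; split=> //.
by rewrite scale0r addr0 add0r lerDl ltW.
Qed.

Lemma support_le_opp C c : C c -> support_le C (- c) (- 1).
Proof.
move=> Cc e e0; exists 1, c; split=> //.
by rewrite scale1r addNr rnorm0 subrr add0r ltW.
Qed.

(** Convexity of [C] lets the two multiples [a *:r c] and [b *:r d] be merged
    into a multiple of a single point of [C]. *)
Lemma support_leD C v w r s : rconvex C ->
  support_le C v r -> support_le C w s -> support_le C (v + w) (r + s).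
Proof.
move=> Cconv vr ws e e0; have e20 : 0 < e / 2 by rewrite divr_gt0.
have [a [c [a0 Cc ac]]] := vr _ e20; have [b [d [b0 Cd bd]]] := ws _ e20.
have [ab0|ab0] := eqVneq (a + b) 0.
  have [a00 b00] : a = 0 /\ b = 0 by lra.
  exists 0, c; split=> //; move: ac bd.
  rewrite a00 b00 !scale0r !addr0 => ac bd.
  by apply: le_trans (rnormD _ _) _; lra.
have abp : 0 < a + b by rewrite lt_def ab0 addr_ge0.
exists (a + b), ((a / (a + b)) *:r c + (1 - a / (a + b)) *:r d); split.
- exact: ltW.
- apply: Cconv => //; first by rewrite divr_ge0// ltW.
  by rewrite ler_pdivrMr// mul1r lerDl.
have -> : (a + b) *:r ((a / (a + b)) *:r c + (1 - a / (a + b)) *:r d) =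
    a *:r c + b *:r d.
  by rewrite scalerDr !rscalerA; congr (_ *:r _ + _ *:r _); field.
by rewrite addrACA; apply: le_trans (rnormD _ _) _; lra.
Qed.

Lemma support_leZ C a v r : 0 < a ->
  support_le C v r -> support_le C (a *:r v) (a * r).
Proof.
move=> a0 vr e e0; have ea0 : 0 < e / a by rewrite divr_gt0.
have [b [c [b0 Cc bc]]] := vr _ ea0.
exists (a * b), c; split=> //; first by rewrite mulr_ge0// ltW.
rewrite -rscalerA -scalerDr rnormZ; last exact: ltW.
rewrite -(ler_pM2l a0) in bc; apply: le_trans bc _.
by rewrite !mulrDr [a * (e / a)]mulrC divfK// gt_eqF.
Qed.

(** Since [rnorm (a *:r c) = a], no negative number bounds the value at [0].
    With additivity, bounds for [v] and for [- v] are thus compatible. *)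
Lemma support_le0 C r : (forall c, C c -> rnorm c = 1) ->
  support_le C 0 r -> 0 <= r.
Proof.
move=> C1 H; apply/ler_addgt0Pr => e e0.
have [a [c [a0 Cc]]] := H _ e0.
by rewrite add0r rnormZ// C1// mulr1 -addrA lerDl.
Qed.

Lemma support_leN C D v r : (forall d, D d -> C (- d)) ->
  support_le D v r -> support_le C (- v) r.
Proof.
move=> DC H e e0; have [a [d [a0 Dd ad]]] := H _ e0.
exists a, (- d); split=> //; first exact: DC.
by rewrite scalerN -opprD rnormN.
Qed.

Lemma support_le_lip C v w r : rconvex C -> C !=set0 ->
  support_le C w r -> support_le C v (r + rnorm (v - w)).
Proof.
move=> Cconv C0 wr; rewrite -[v in support_le _ v _](subrK w) addrC.
by apply: support_leD => //; exact: support_le_rnorm.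
Qed.

End support.

(** * Bounded functions on a set *)

Section linf_tools.
Context {R : realType} {G : Type}.
Local Notation E := (linf R G).
Implicit Types (f x y : E) (g d : G) (M : R).

Lemma normc_le_rnorm f g : normc (f g) <= rnorm f.
Proof. by rewrite -lecR -rnormE; exact: linf_norm_ub. Qed.

Lemma rnorm_linf_le f M : 0 <= M -> (forall g, normc (f g) <= M) ->
  rnorm f <= M.
Proof. by move=> M0 fM; rewrite -lecR -rnormE; exact: linf_norm_le. Qed.

Lemma linf_ex (h : G -> R[i]) M : (forall g, normc (h g) <= M) ->
  exists f, forall g, f g = h g.
Proof.
move=> hM; have hP : h \in linf_pred R G by apply/linf_predP; exists M.
by exists (Linf hP).
Qed.

Lemma rnorm1P f g : (forall d, normc (f d) <= 1) -> normc (f g) = 1 ->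
  rnorm f = 1.
Proof.
move=> f1 fg; apply/le_anti; rewrite rnorm_linf_le//= -fg.
exact: normc_le_rnorm.
Qed.

Lemma sphere_normc_le f g : rnorm f = 1 -> normc (f g) <= 1.
Proof. by move=> <-; exact: normc_le_rnorm. Qed.

Definition upd (h : G -> R[i]) g z : G -> R[i] :=
  fun d => if `[< d = g >] then z else h d.

Lemma upd_eq h g z : upd h g z g = z.
Proof. by rewrite /upd; case: asboolP. Qed.

Lemma upd_neq h g z d : d <> g -> upd h g z d = h d.
Proof. by rewrite /upd; case: asboolP. Qed.

Lemma upd_ex f g z M : rnorm f <= M -> normc z <= M ->
  exists2 f' : E, f' g = z & forall d, d <> g -> f' d = f d.
Proof.
move=> fM zM; have [|f' f'E] := @linf_ex (upd f g z) M.
  move=> d; have [->|dg] := pselect (d = g); first by rewrite upd_eq.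
  by rewrite upd_neq//; exact: le_trans (normc_le_rnorm _ _) fM.
by exists f' => [|d dg]; rewrite f'E ?upd_eq ?upd_neq.
Qed.

Lemma rnorm_sub_upd f f' g : (forall d, d <> g -> f' d = f d) ->
  rnorm (f - f') <= normc (f g - f' g).
Proof.
move=> ff'; apply: rnorm_linf_le => [|d]; first exact: normc_ge0.
have [->//|dg] := pselect (d = g).
by rewrite linfD linfN ff'// subrr normc0 normc_ge0.
Qed.

Lemma sup_off f g : (exists d, d <> g) -> exists M,
  (forall d, d <> g -> normc (f d) <= M) /\
  (forall e, 0 < e -> exists2 d, d <> g & M - e < normc (f d)).
Proof.
move=> [d0 d0g]; pose A := [set normc (f d) | d in [set d | d <> g]].
have supA : has_sup A.
  split; first by exists (normc (f d0)), d0.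
  by exists (rnorm f) => _ [d _ <-]; exact: normc_le_rnorm.
exists (sup A); split=> [d dg|e e0].
  by apply: (sup_upper_bound supA); exists d.
by have [_ [d dg <-] H] := sup_adherent e0 supA; exists d.
Qed.

End linf_tools.

(** * Maximal faces of the unit sphere of bounded functions *)

Section faces.
Context {R : realType} {G : Type}.
Local Notation E := (linf R G).
Implicit Types (x y w : E) (g d : G) (l : R[i]).

Definition face g l : set E := [set x : E | rnorm x = 1 /\ x g = l].

(** Functions whose modulus off [g] is bounded away from [1]. For an
    element of [face g l] this means lying in the relative interior. *)
Definition peaked g x := exists2 e : R, 0 < e &
  forall d, d <> g -> normc (x d) <= 1 - e.

Lemma faceP x g l : normc l = 1 -> x g = l ->
  (forall d, d <> g -> normc (x d) <= 1) -> face g l x.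
Proof.
move=> l1 xg x1; split=> //; apply: (@rnorm1P _ _ _ g); last by rewrite xg.
by move=> d; have [->|dg] := pselect (d = g); [rewrite xg l1|exact: x1].
Qed.

Lemma face_far x w g l : normc l = 1 -> face g l x -> face g (- l) w ->
  rnorm (x - w) = 2.
Proof.
move=> l1 [x1 xg] [w1 wg]; apply/le_anti/andP; split.
  by apply: le_trans (rnormD _ _) _; rewrite rnormN x1 w1; lra.
apply: le_trans (normc_le_rnorm (x - w) g).
rewrite linfD linfN xg wg opprK.
have -> : l + l = 2%:C * l by rewrite rmorphD/= mulrDl !mul1r.
by rewrite normcM l1 normc_real ?mulr1.
Qed.

(** Off [g] the two functions are at distance at most [2 - e], so the distance
    [2] must be reached at [g], where it forces antipodal values. Together with
    [face_far], this describes the face opposite to [face g l] by the metric of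
    the sphere alone. *)
Lemma peaked_far x w g l : normc l = 1 -> face g l x -> peaked g x ->
  rnorm w = 1 -> rnorm (x - w) = 2 -> face g (- l) w.
Proof.
move=> l1 [x1 xg] [e e0 xe] w1 xw; split=> //.
have far : 2 <= normc (l - w g).
  rewrite leNgt; apply/negP => near.
  have: rnorm (x - w) <= Num.max (2 - e) (normc (l - w g)).
    apply: rnorm_linf_le => [|d]; first by rewrite le_max normc_ge0 orbT.
    rewrite linfD linfN le_max; have [->|dg] := pselect (d = g).
      by rewrite xg lexx orbT.
    apply/orP; left; apply: le_trans (le_normcD _ _) _; rewrite normcN.
    by have := xe _ dg; have := sphere_normc_le d w1; lra.
  rewrite xw le_max => /orP[|]; last by rewrite leNgt near.
  by lra.
have wg1 := sphere_normc_le g w1.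
have lw : normc (l - w g) = 2 * 1.
  apply/le_anti; rewrite mulr1 far andbT.
  by apply: le_trans (le_normcD _ _) _; rewrite normcN l1; lra.
have := @metric_midpointc _ 0 l (w g) 1 ler01 lw.
rewrite !sub0r !normcN l1 => /(_ (lexx _) wg1)/esym/eqP.
rewrite mulf_eq0 => /orP[|/eqP lw0].
  by rewrite eq_complex/= eqxx andbT invr_eq0 pnatr_eq0.
by apply/eqP; rewrite -addr_eq0 addrC lw0.
Qed.

Lemma bump_ex g l : normc l = 1 -> exists x, face g l x /\ peaked g x.
Proof.
move=> l1; have [||x xg x0] := @upd_ex R G 0 g l 1.
- by rewrite rnorm0.
- by rewrite l1.
exists x; split; last by exists 1 => // d dg; rewrite x0// subrr normc0.
by apply: faceP => // d dg; rewrite x0// normc0.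
Qed.

(** Scaling down off [g] makes a function peaked. *)
Lemma peaked_dense x g l (e : R) : normc l = 1 -> face g l x -> 0 < e ->
  exists y, [/\ face g l y, peaked g y & rnorm (x - y) <= e].
Proof.
move=> l1 [x1 xg] e0.
wlog e1 : e e0 / e <= 1.
  move=> H; have [e1|e1] := leP e 1; first exact: H.
  have [y [fy py xy]] := H _ ltr01 (lexx _).
  by exists y; split=> //; apply: le_trans xy (ltW e1).
have e1' : 0 <= 1 - e by lra.
have yn d : normc (((1 - e) *:r x) d) <= 1 - e.
  rewrite linfZ normcM normc_real// ler_piMr//; exact: sphere_normc_le.
have yR : rnorm ((1 - e) *:r x) <= 1 by rewrite rnormZ// x1; lra.
have l1' : normc l <= 1 by rewrite l1.
have [y yg yd] := upd_ex g yR l1'.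
exists y; split; last first.
- apply: rnorm_linf_le => [|d]; first exact: ltW.
  rewrite linfD linfN; have [->|dg] := pselect (d = g).
    by rewrite xg yg subrr normc0 ltW.
  rewrite yd// linfZ -[X in X - _]mul1r -mulrBl.
  have -> : 1 - (1 - e)%:C = e%:C :> R[i] by rewrite rmorphB rmorph1 subKr.
  rewrite normcM normc_real ?(ltW e0)//.
  by rewrite ler_piMr ?(ltW e0)//; exact: sphere_normc_le.
- by exists e => // d dg; rewrite yd.
- by apply: faceP => // d dg; rewrite yd//; apply: le_trans (yn d) _; lra.
Qed.

End faces.

(** * Images of the faces under a surjective isometry of spheres *)

Section isometry.
Context {R : realType} {G : Type} {X : normedModType R[i]}.
Local Notation E := (linf R G).
Variable Delta : E -> X.
Hypothesis Delta1 : forall x : E, rnorm x = 1 -> rnorm (Delta x) = 1.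
Hypothesis Delta_surj : forall v, rnorm v = 1 ->
  exists2 x : E, rnorm x = 1 & Delta x = v.
Hypothesis Delta_iso : forall x y : E, rnorm x = 1 -> rnorm y = 1 ->
  rnorm (Delta x - Delta y) = rnorm (x - y).
Implicit Types (x y w : E) (g d : G) (l : R[i]) (t : R).

(** The vector [- Delta x] is [Delta w] for some [w] at distance [2] from [x].
    As [x] is peaked, [w] is in the opposite face, which is at distance [2]
    from the whole of [face g l]. *)
Lemma face_sum x y g l : normc l = 1 -> face g l x -> peaked g x ->
  face g l y -> rnorm (Delta x + Delta y) = 2.
Proof.
move=> l1 fx px fy; have [x1 _] := fx; have [y1 _] := fy.
have [|w w1 wE] := Delta_surj (v := - Delta x); first by rewrite rnormN Delta1.
have fw : face g (- l) w.
  apply: (peaked_far l1 fx px w1).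
  rewrite -Delta_iso// wE opprK -[Delta x]scale1r -rscalerDl.
  by rewrite rnormZ// Delta1// mulr1.
by rewrite addrC -[Delta x]opprK -wE Delta_iso//; exact: face_far fy fw.
Qed.

(** Call [v] the convex combination. It has norm [1] by [face_sum], so [- v]
    is some [Delta w]; and [rnorm (v + v) = 2] is only possible if
    [rnorm (Delta x + v) = 2], because [x] has positive weight. So [w] is at
    distance [2] from the peaked [x], hence in the opposite face. *)
Lemma face_comb_peaked x y b t g l : normc l = 1 -> face g l x ->
  peaked g x -> face g l y -> face g l b -> 0 < t -> t <= 1 ->
  rnorm (t *:r Delta x + (1 - t) *:r Delta y + Delta b) = 2.
Proof.
move=> l1 fx px fy fb t0 t1; set v := _ + _ *:r _.
have [x1 _] := fx; have [y1 _] := fy; have [b1 _] := fb.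
have t1' : 0 <= 1 - t by lra.
have v1 : rnorm v = 1.
  apply: rnorm_convex_comb; rewrite ?Delta1 ?(face_sum l1 fx)//.
  exact: ltW.
have [|w w1 wE] := Delta_surj (v := - v); first by rewrite rnormN.
have xv : rnorm (Delta x + v) = 2.
  apply/le_anti/andP; split.
    by apply: le_trans (rnormD _ _) _; rewrite v1 Delta1//; lra.
  have : rnorm (v + v) <= t * rnorm (Delta x + v) +
      (1 - t) * rnorm (Delta y + v).
    rewrite -(rnormZ _ (ltW t0)) -(rnormZ _ t1').
    by apply: le_trans (rnormD _ _); rewrite rcombD.
  have -> : rnorm (v + v) = 2.
    by rewrite -[v]scale1r -rscalerDl rnormZ// v1 mulr1.
  have : rnorm (Delta y + v) <= 2.
    by apply: le_trans (rnormD _ _) _; rewrite v1 Delta1//; lra.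
  move=> yv H; rewrite -(ler_pM2l t0).
  have : (1 - t) * rnorm (Delta y + v) <= (1 - t) * 2 by rewrite ler_wpM2l.
  by lra.
have fw : face g (- l) w.
  by apply: (peaked_far l1 fx px w1); rewrite -Delta_iso// wE opprK.
by rewrite addrC -[v]opprK -wE Delta_iso//; exact: face_far fb fw.
Qed.

(** For peaked [x] this follows from [face_comb_peaked]; in general [x] is a
    limit of peaked points, and the distance to the bump [b], which recognizes
    membership in the opposite face, is continuous. *)
Lemma face_opp x y t g l : normc l = 1 -> face g l x -> face g l y ->
  0 <= t -> t <= 1 ->
  exists2 w, face g (- l) w & Delta w = - (t *:r Delta x + (1 - t) *:r Delta y).
Proof.
move=> l1 fx fy; wlog t0 : x y t fx fy / 0 < t.
  (* The case [t = 0] is the case [t = 1] with [x] and [y] exchanged. *)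
  move=> H t0 t1; have [t00|t0'] := eqVneq t 0.
    have [w fw wE] := H y x 1 fy fx ltr01 ler01 (lexx _).
    by exists w => //; rewrite wE t00 subrr subr0 addrC.
  by apply: H => //; rewrite lt_def t0'.
move=> _ t1; set v := _ + _.
have [x1 _] := fx; have [y1 _] := fy.
have t1' : 0 <= 1 - t by lra.
have [b [fb pb]] := bump_ex g l1; have [b1 _] := fb.
have vle : rnorm v <= 1.
  by apply: le_trans (rnormD _ _) _; rewrite !rnormZ ?(ltW t0)// !Delta1//; lra.
have vb : 2 <= rnorm (v + Delta b).
  apply/ler_addgt0Pr => e e0; have [z [fz pz xz]] := peaked_dense l1 fx e0.
  have [z1 _] := fz.
  rewrite -(face_comb_peaked l1 fz pz fy fb t0 t1).
  rewrite -[_ + _ + Delta b](subrK (v + Delta b)).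
  apply: le_trans (rnormD _ _) _; rewrite addrC lerD2l.
  rewrite opprD addrACA subrr addr0 /v opprD addrACA subrr addr0 -scalerBr.
  rewrite rnormZ ?(ltW t0)// Delta_iso// rnorm_distC.
  by apply: le_trans xz; rewrite ler_piMl// rnorm_ge0.
have v1 : rnorm v = 1.
  apply/le_anti; rewrite vle/=.
  by have := rnormD v (Delta b); rewrite Delta1//; lra.
have [|w w1 wE] := Delta_surj (v := - v); first by rewrite rnormN.
exists w => //; apply: (peaked_far l1 fb pb w1).
rewrite -Delta_iso// wE opprK addrC; apply/le_anti; rewrite vb andbT.
by apply: le_trans (rnormD _ _) _; rewrite Delta1// v1; lra.
Qed.

Lemma face_image_opp x g l : normc l = 1 -> face g l x ->
  (Delta @` face g (- l)) (- Delta x).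
Proof.
move=> l1 fx; have [w fw wE] := face_opp l1 fx fx ler01 (lexx _).
by exists w => //; rewrite wE subrr scale0r addr0 scale1r.
Qed.

(** Passing to the opposite face twice removes the sign in [face_opp]. *)
Lemma face_image_convex g l : normc l = 1 -> rconvex (Delta @` face g l).
Proof.
move=> l1 _ _ t [x fx <-] [y fy <-] t0 t1.
have [w fw wE] := face_opp l1 fx fy t0 t1.
have := @face_image_opp w g (- l); rewrite normcN opprK => /(_ l1 fw).
by rewrite wE opprK.
Qed.

(** The midpoint of [Delta x] and [Delta y] lies in the convex image of the
    face, so it is [Delta m] where [m] is a metric midpoint of [x] and [y].
    Since [x - y] has constant modulus off [g], each value [m d] with [d <> g]
    is a metric midpoint of [x d] and [y d], and [m] is the arithmetic midpoint
    by [metric_midpointc]. *)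
Lemma face_midpoint x y (z : E) g l (r : R) : normc l = 1 -> 0 <= r ->
  face g l x -> face g l y ->
  (forall d, d <> g -> normc (x d - y d) = 2 * r) ->
  (forall d, z d = 2^-1%:C * (x d + y d)) ->
  Delta z = 2^-1 *:r (Delta x + Delta y).
Proof.
move=> l1 r0 fx fy xy zE; have [x1 xg] := fx; have [y1 yg] := fy.
have [||m fm mE] := face_image_convex (t := 2^-1) l1 (imageP Delta fx)
  (imageP Delta fy); [lra|lra|].
have [m1 mg] := fm.
have h : 1 - 2^-1 = 2^-1 :> R by field.
rewrite h -scalerDr in mE; rewrite -mE; congr Delta.
have xyr : rnorm (x - y) <= 2 * r.
  apply: rnorm_linf_le => [|d]; first by rewrite mulr_ge0.
  rewrite linfD linfN; have [->|dg] := pselect (d = g); last by rewrite xy.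
  by rewrite xg yg subrr normc0 mulr_ge0.
have near (u v : E) : rnorm u = 1 -> rnorm v = 1 -> rnorm (u - v) <= 2 * r ->
    Delta m = 2^-1 *:r (Delta u + Delta v) -> rnorm (m - u) <= r.
  move=> u1 v1 uv mE'; rewrite -Delta_iso// mE'.
  rewrite -[X in _ - X]rhalfD -scalerBr opprD addrACA subrr add0r.
  rewrite rnormZ// Delta_iso// rnorm_distC; lra.
have mx : rnorm (m - x) <= r by exact: near mE.
have my : rnorm (m - y) <= r.
  by apply: (near y x) => //; [rewrite rnorm_distC|rewrite [_ y + _]addrC].
apply: linf_eq => d; rewrite zE; have [->|dg] := pselect (d = g).
  by rewrite mg xg yg halfcD.
apply/esym/(metric_midpointc r0 (xy _ dg)); rewrite -linfN -linfD.
  exact: le_trans (normc_le_rnorm _ _) mx.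
exact: le_trans (normc_le_rnorm _ _) my.
Qed.

(** * Values of the supporting functionals *)

Local Notation face_le g l := (support_le (Delta @` face g l)).

Lemma face_le_lip g l (v w : X) (r : R) : normc l = 1 ->
  face_le g l w r -> face_le g l v (r + rnorm (v - w)).
Proof.
move=> l1; apply: support_le_lip; first exact: face_image_convex.
by have [b [fb _]] := bump_ex g l1; exists (Delta b), b.
Qed.

Lemma face_leN g l (v : X) (r : R) : normc l = 1 ->
  face_le g (- l) v r -> face_le g l (- v) r.
Proof.
move=> l1; apply: support_leN => _ [x fx <-].
rewrite -[l]opprK; apply: face_image_opp fx; by rewrite normcN.
Qed.

(** Replacing the value of [y] at [g] by [- l] moves [y] by
    [normc (l + y g)] into the opposite face, on which the bound is [- 1]. *)
Lemma face_le_normc g l y : normc l = 1 -> rnorm y = 1 ->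
  face_le g l (Delta y) (normc (l + y g) - 1).
Proof.
move=> l1 y1; have Nl1 : normc (- l) = 1 by rewrite normcN.
have [||x xg xy] := @upd_ex _ _ y g (- l) 1; rewrite ?y1 ?Nl1//.
have fx : face g (- l) x.
  by apply: faceP => // d dg; rewrite xy//; exact: sphere_normc_le.
have [x1 _] := fx.
have : face_le g l (Delta x) (- 1).
  rewrite -[Delta x]opprK; apply: support_le_opp.
  by have := face_image_opp Nl1 fx; rewrite opprK.
move=> /(face_le_lip (Delta y) l1); apply: support_leW.
rewrite addrC lerD2r Delta_iso//.
by apply: le_trans (rnorm_sub_upd xy) _; rewrite xg opprK addrC.
Qed.

(** If [x] vanishes at [g], the bound [face_le_normc] for [x] is [0] for both
    [l] and [- l], so [Delta x] does not contribute. *)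
Lemma face_le_double g l x y z (r : R) : normc l = 1 -> rnorm x = 1 ->
  x g = 0 -> Delta z = 2^-1 *:r (Delta x + Delta y) ->
  face_le g l (Delta z) r -> face_le g l (Delta y) (2 * r).
Proof.
move=> l1 x1 xg zE /(support_leZ (ltr0Sn _ 1)); rewrite zE rscalerA divff//.
rewrite scale1r => H; rewrite -[Delta y](addKr (Delta x)) addrC -[2 * r]addr0.
apply: support_leD => //; first exact: face_image_convex.
apply: face_leN => //; have Nl1 : normc (- l) = 1 by rewrite normcN.
by have := face_le_normc g Nl1 x1; rewrite xg addr0 Nl1 subrr.
Qed.

(** The bound [normc (l + z g) - 1] agrees with the wanted [cdot l (z g)] up to
    a quadratic error, so it is sharp infinitesimally at functions vanishing at
    [g]. Join [y] to such a function inside [face d (y d)] by the segment of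
    functions [z t] obtained by adding [t - tau] to the modulus of [y] at all
    indices except [d], where [tau] is the modulus of [y g]. Differences of
    points of this segment have constant modulus off [d], so [face_midpoint]
    applies: the bound at [z t] is twice the bound at [z (t / 2)]. Halving [t]
    repeatedly makes the quadratic error vanish. *)
Lemma face_le_cdot_attained g d l y : normc l = 1 -> rnorm y = 1 ->
  d <> g -> normc (y d) = 1 -> face_le g l (Delta y) (cdot l (y g)).
Proof.
move=> l1 y1 dg yd; have yn h : normc (y h) <= 1 by exact: sphere_normc_le.
pose tau := normc (y g); pose c := cdot l (dirc (y g)).
pose line (t : R) (z : E) := face d (y d) z /\
  forall h, h <> d -> z h = (normc (y h) - tau + t)%:C * dirc (y h).
have lineP t : 0 <= t -> t <= tau -> exists z, line t z.
  move=> t0 ttau.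
  pose q h := if `[< h = d >] then y d else
    (normc (y h) - tau + t)%:C * dirc (y h).
  have q1 h : normc (q h) <= 1.
    rewrite /q; case: asboolP => _; first by rewrite yd.
    rewrite normc_scale_dirc normc_abs ler_norml.
    have := yn h; have := yn g; have := normc_ge0 (y h).
    rewrite -/tau => *; apply/andP; split; lra.
  have [z zE] := linf_ex q1; exists z; split.
    apply: faceP => // [|h _]; last by rewrite zE.
    by rewrite zE /q; case: asboolP.
  by move=> h hd; rewrite zE /q; case: asboolP.
have line_g t z : line t z -> z g = t%:C * dirc (y g).
  by move=> [_ ->]; [rewrite subrr add0r|exact/nesym].
have tau0 : 0 <= tau := normc_ge0 _.
have main n t z : 0 <= t -> t <= tau -> line t z ->
    face_le g l (Delta z) (t * c + t ^+ 2 / 2 ^+ n.+1).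
  elim: n t z => [|n IH] t z t0 ttau Lz.
    have [[z1 _] _] := Lz; apply: support_leW (face_le_normc g l1 z1).
    apply: le_trans (normcD_le_cdot _ l1) _.
    rewrite (line_g _ _ Lz) -sqr_normc normc_scale_dirc normc_real//.
    by rewrite cdotZ expr1.
  have t20 : 0 <= t / 2 by rewrite divr_ge0.
  have t2tau : t / 2 <= tau by lra.
  have [x Lx] := lineP _ (lexx 0) tau0; have [w Lw] := lineP _ t20 t2tau.
  have [fx xE] := Lx; have [fz zE] := Lz; have [fw wE] := Lw.
  have [x1 xd] := fx; have [_ zd] := fz; have [_ wd] := fw.
  have -> : t * c + t ^+ 2 / 2 ^+ n.+2 =
      2 * (t / 2 * c + (t / 2) ^+ 2 / 2 ^+ n.+1).
    rewrite [2 ^+ n.+2]exprS; field; exact: expf_neq0.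
  apply: (@face_le_double _ _ x z w) => //; last exact: IH.
    by rewrite (line_g _ _ Lx) mul0r.
  apply: (face_midpoint (r := t / 2) yd _ fx fz) => // h.
    move=> hd; rewrite xE// zE// -mulrBl normc_scale_dirc -rmorphB normc_abs.
    rewrite (_ : _ + 0 - _ = - t); last by ring.
    by rewrite normrN ger0_norm//; field.
  have [->|hd] := pselect (h = d).
    by rewrite xd zd wd halfcD.
  rewrite wE// xE// zE// -mulrDl mulrA -rmorphD -rmorphM.
  by congr (_%:C * _); field.
have Ly : line tau y.
  split=> [|h hd]; first by split.
  by rewrite subrK -polarE.
have -> : cdot l (y g) = tau * c by rewrite {1}[y g]polarE cdotZ.
apply: support_le_closed => e e0.
(* Take [n] with [tau ^+ 2 / e <= n <= 2 ^+ n.+1]. *)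
pose n := Num.bound (tau ^+ 2 / e).
apply: support_leW (main n tau y tau0 (lexx _) Ly); rewrite lerD2l.
rewrite ler_pdivrMr ?exprn_gt0// mulrC -ler_pdivrMr//.
have b0 : 0 <= tau ^+ 2 / e by rewrite divr_ge0 ?sqr_ge0 ?ltW.
apply: le_trans (ltW (archi_boundP b0)) _.
by rewrite -natrX ler_nat -/n; apply: leq_trans (ltnW (ltn_expl n.+1 _)).
Qed.

(** Let [M] be the supremum of the modulus of [y] off [g]. A small perturbation
    makes it attained, at some [d]. If [M = 1], [face_le_cdot_attained]
    applies. Otherwise [y g] is unimodular, and the perturbed function [x] is
    the midpoint of the two functions obtained from it by replacing the moduli
    off [g] with
    [normc (x h) +i* (+- sqrt (1 - M ^+ 2))]. These have modulus [1] at [d],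
    share the value [y g], and their difference has constant modulus off [g],
    so the bound passes to [x] by [face_midpoint]. *)
Lemma face_le_cdot g l y : (exists d, d <> g) -> normc l = 1 ->
  rnorm y = 1 -> face_le g l (Delta y) (cdot l (y g)).
Proof.
move=> g2 l1 y1; have yn h : normc (y h) <= 1 by exact: sphere_normc_le.
have [M [yM My]] := sup_off y g2.
have [d0 d0g] := g2.
have M0 : 0 <= M := le_trans (normc_ge0 _) (yM _ d0g).
have M1 : M <= 1.
  apply/ler_addgt0Pr => e /My[d dg]; have := yn d; lra.
apply: support_le_closed => e e0; have [d dg yd] := My e e0.
have Mdn : normc (M%:C * dirc (y d)) = M.
  by rewrite normc_scale_dirc normc_real.
have [||x xd xy] := @upd_ex _ _ y d (M%:C * dirc (y d)) 1.
- by rewrite y1.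
- by rewrite Mdn.
have gd : g <> d by exact/nesym.
have xM h : h <> g -> normc (x h) <= M.
  move=> hg; have [->|hd] := pselect (h = d); first by rewrite xd Mdn.
  by rewrite xy//; exact: yM.
have xg : x g = y g by rewrite xy.
have xn h : normc (x h) <= 1.
  have [->|hg] := pselect (h = g); first by rewrite xg.
  exact: le_trans (xM _ hg) M1.
have dist : rnorm (y - x) <= e.
  apply: le_trans (rnorm_sub_upd xy) _.
  rewrite xd [X in X - _]polarE -mulrBl normc_scale_dirc -rmorphB normc_abs.
  rewrite ler_norml; have := yM _ dg; move=> ?; apply/andP; split; lra.
suff [x1 H] : rnorm x = 1 /\ face_le g l (Delta x) (cdot l (y g)).
  apply: support_leW (face_le_lip (Delta y) l1 H).
  by rewrite lerD2l Delta_iso.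
have [Me1|Mn1] := eqVneq M 1.
  have xd1 : normc (x d) = 1 by rewrite xd Mdn.
  have x1 : rnorm x = 1 by apply: rnorm1P xd1.
  split=> //; rewrite -xg; exact: face_le_cdot_attained xd1.
have yg : normc (y g) = 1.
  apply/le_anti; rewrite yn/= leNgt; apply/negP => yg.
  have: rnorm y <= Num.max M (normc (y g)).
    apply: rnorm_linf_le => [|h]; first by rewrite le_max M0.
    rewrite le_max; have [->|/yM->//] := pselect (h = g).
    by rewrite lexx orbT.
  rewrite y1 le_max => /orP[|]; last by rewrite leNgt yg.
  by rewrite leNgt lt_neqAle Mn1 M1.
split; first by apply: (@rnorm1P _ _ _ g) => //; rewrite xg.
pose s := Num.sqrt (1 - M ^+ 2).
have M2 : M ^+ 2 <= 1 by rewrite expr_le1.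
have s2 : s ^+ 2 = 1 - M ^+ 2 by rewrite sqr_sqrtr// subr_ge0.
have s0 : 0 <= s := sqrtr_ge0 _.
have side (b : R) : b ^+ 2 = 1 - M ^+ 2 -> exists p : E,
    [/\ face g (y g) p, face_le g l (Delta p) (cdot l (y g)) &
        forall h, h <> g -> p h = (normc (x h) +i* b) * dirc (x h)].
  move=> b2.
  pose q h := if `[< h = g >] then y g else (normc (x h) +i* b) * dirc (x h).
  have q1 h : normc (q h) <= 1.
    rewrite /q; case: asboolP => [_|hg]; first by rewrite yg.
    rewrite normc_scale_dirc normc_le// /normc2/= b2 expr1n.
    have : normc (x h) ^+ 2 <= M ^+ 2.
      by rewrite ler_pXn2r ?nnegrE ?normc_ge0// xM.
    by lra.
  have [p pE] := linf_ex q1.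
  have pg : p g = y g by rewrite pE /q; case: asboolP.
  have fp : face g (y g) p by apply: faceP => // h _; rewrite pE.
  have pE' h : h <> g -> p h = (normc (x h) +i* b) * dirc (x h).
    by rewrite pE /q; case: asboolP.
  exists p; split=> //; rewrite -pg; have [p1 _] := fp.
  apply: (face_le_cdot_attained l1 p1 dg); rewrite pE'// normc_scale_dirc.
  apply/eqP; rewrite -(@eqrXn2 _ 2) ?normc_ge0// sqr_normc /normc2/=.
  by rewrite b2 xd Mdn expr1n addrC subrK.
have [p [fp pH pE]] := side s s2.
have [|q [fq qH qE]] := side (- s); first by rewrite sqrrN.
rewrite (face_midpoint (r := s) (z := x) yg s0 fp fq); last first.
- move=> h; have [->|hg] := pselect (h = g).
    have [_ ->] := fp; have [_ ->] := fq.
    by rewrite xg halfcD.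
  rewrite pE// qE// -mulrDl mulrA {1}[x h]polarE; congr (_ * _).
  by apply/eqP; rewrite eq_complex/=; apply/andP; split; apply/eqP; field.
- move=> h hg; rewrite pE// qE// -mulrBl normc_scale_dirc.
  apply/eqP; rewrite -(@eqrXn2 _ 2) ?normc_ge0 ?mulr_ge0// sqr_normc /normc2/=.
  by apply/eqP; ring.
have -> : cdot l (y g) = 2^-1 * (cdot l (y g) + cdot l (y g)) by field.
apply: support_leZ; first by rewrite invr_gt0.
by apply: support_leD => //; exact: face_image_convex.
Qed.

(** * The homogeneous extension *)

Definition hom_ext x : X := rnorm x *:r Delta ((rnorm x)^-1 *:r x).

Lemma hom_ext0 : hom_ext 0 = 0.
Proof. by rewrite /hom_ext rnorm0 scale0r. Qed.

Lemma hom_ext_sphere x : rnorm x = 1 -> hom_ext x = Delta x.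
Proof. by move=> x1; rewrite /hom_ext x1 invr1 !scale1r. Qed.

Lemma hom_extZ (a : R) x : 0 < a -> hom_ext (a *:r x) = a *:r hom_ext x.
Proof.
move=> a0; have [->|x0] := eqVneq x 0.
  by rewrite scaler0 hom_ext0 scaler0.
have [xp _] := rnorm_normalize x0.
rewrite /hom_ext rnormZ ?(ltW a0)// !rscalerA; congr (_ *:r Delta (_ *:r _)).
by field; rewrite !gt_eqF.
Qed.

Lemma rnorm_hom_ext x : rnorm (hom_ext x) = rnorm x.
Proof.
have [->|/rnorm_normalize[xp x1]] := eqVneq x 0.
  by rewrite hom_ext0 !rnorm0.
by rewrite rnormZ ?rnorm_ge0// Delta1// mulr1.
Qed.

Lemma hom_ext_surj v : exists x, hom_ext x = v.
Proof.
have [->|/rnorm_normalize[vp /Delta_surj[x x1 xE]]] := eqVneq v 0.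
  by exists 0; rewrite hom_ext0.
exists (rnorm v *:r x); rewrite hom_extZ// hom_ext_sphere// xE rscalerKV//.
by rewrite gt_eqF.
Qed.

Hypothesis G2 : forall g : G, exists d, d <> g.

Lemma face_le_hom_ext g l x : normc l = 1 ->
  face_le g l (hom_ext x) (cdot l (x g)).
Proof.
move=> l1; have [->|/rnorm_normalize[xp x1]] := eqVneq x 0.
  have [b [fb _]] := bump_ex g l1.
  have : face_le g l (0 : X) (rnorm (0 : X)).
    by apply: support_le_rnorm; exists (Delta b), b.
  by rewrite hom_ext0 rnorm0 /cdot !mulr0 addr0.
have := support_leZ xp (face_le_cdot (G2 g) l1 x1).
by rewrite linfZ cdotZ mulrA divff ?gt_eqF// mul1r.
Qed.

(** The sum is [hom_ext w] for some [w] by surjectivity. Subadditivity of the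
    supporting bounds compares [w g] with [x g + y g] in every direction [l],
    which identifies [w] with [x + y]. *)
Lemma hom_extD x y : hom_ext (x + y) = hom_ext x + hom_ext y.
Proof.
have [w wE] := hom_ext_surj (hom_ext x + hom_ext y).
rewrite -wE; congr hom_ext; apply: linf_eq => g; apply/esym/cdot_inj => l l1.
have Nl1 : normc (- l) = 1 by rewrite normcN.
have cv := face_image_convex (g := g) l1.
(* Bounds for [hom_ext x + hom_ext y - hom_ext w], which is [0]. *)
have := support_leD cv (support_leD cv (face_le_hom_ext g x l1)
  (face_le_hom_ext g y l1)) (face_leN l1 (face_le_hom_ext g w Nl1)).
rewrite wE subrr cdotNl -cdotD -linfD => /support_le0; rewrite subr_ge0.
by apply=> _ [b [b1 _] <-]; exact: Delta1.
Qed.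

Lemma hom_extN x : hom_ext (- x) = - hom_ext x.
Proof. by apply/eqP; rewrite -addr_eq0 -hom_extD addNr hom_ext0. Qed.

Lemma hom_ext_real_linear : real_linear hom_ext.
Proof.
move=> a x y; rewrite hom_extD; congr (_ + _).
have [a0|a0|->] := ltgtP a 0; last 1 first.
- by rewrite !scale0r hom_ext0.
- rewrite -[a]opprK !(rmorphN _ (- a)) !scaleNr hom_extN hom_extZ//.
  by rewrite oppr_gt0.
exact: hom_extZ.
Qed.

Lemma hom_ext_iso x y : rnorm (hom_ext x - hom_ext y) = rnorm (x - y).
Proof. by rewrite -hom_extN -hom_extD rnorm_hom_ext. Qed.

End isometry.

Lemma real_linear_sphere_inj (R : realType) (E : normedModType R[i])
    (X : lmodType R[i]) (S T : E -> X) : real_linear S -> real_linear T ->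
  (forall x, rnorm x = 1 -> S x = T x) -> S = T.
Proof.
have lin (U : E -> X) : real_linear U ->
    U 0 = 0 /\ forall (a : R) x, U (a *:r x) = a *:r U x.
  move=> linU; have U0 : U 0 = 0.
    have := linU 1 0 0; rewrite !scale1r addr0 => /eqP.
    by rewrite -subr_eq0 opprD addNKr oppr_eq0 => /eqP.
  by split=> // a x; have := linU a x 0; rewrite U0 !addr0.
move=> /lin[S0 SZ] /lin[T0 TZ] ST; apply/funext => x.
have [->|/rnorm_normalize[xp x1]] := eqVneq x 0; first by rewrite S0 T0.
have -> : x = rnorm x *:r ((rnorm x)^-1 *:r x).
  by rewrite rscalerKV// gt_eqF.
by rewrite SZ TZ ST.
Qed.

Lemma infinite_set_neq (G : Type) : infinite_set [set: G] ->
  forall g : G, exists d, d <> g.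
Proof.
move=> Ginf g; apply/not_existsP => H; apply: Ginf.
suff -> : [set: G] = [set g] by exact: finite_set1.
by apply/seteqP; split=> // d _; apply: contrapT; exact: H.
Qed.

Theorem theorem1p1 (R : realType) (Gamma : Type)
    (Gamma_infinite : infinite_set [set: Gamma]%classic) :
  mazur_ulam_property (linf R Gamma).
Proof.
move=> X Delta [Dfun Dsurj Diso].
have D1 (x : linf R Gamma) : rnorm x = 1 -> rnorm (Delta x) = 1.
  by move=> /unit_sphereE/Dfun/unit_sphereE.
have Ds (v : X) : rnorm v = 1 ->
    exists2 x : linf R Gamma, rnorm x = 1 & Delta x = v.
  by move=> /unit_sphereE/Dsurj[x /unit_sphereE]; exists x.
have Di (x y : linf R Gamma) : rnorm x = 1 -> rnorm y = 1 ->
    rnorm (Delta x - Delta y) = rnorm (x - y).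
  move=> /unit_sphereE x1 /unit_sphereE y1; congr complex.Re; exact: Diso.
have G2 := infinite_set_neq Gamma_infinite.
have lin := hom_ext_real_linear D1 Ds Di G2.
exists (hom_ext Delta); split.
  split=> //; last by move=> x /unit_sphereE; exact: hom_ext_sphere.
  split=> // [v _|x y _ _]; last by rewrite !rnormE (hom_ext_iso D1 Ds Di G2).
  by have [x xE] := hom_ext_surj Ds v; exists x.
move=> T [linT _ TE]; apply: real_linear_sphere_inj => // x x1.
by rewrite hom_ext_sphere// TE//; exact/unit_sphereE.
Qed.
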